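(* Let $(X,\perp)$ be a finite orthogonality space of rank $3$ fulfilling (L1). Then $(X,\perp)$ is of the form $\mathbf{3}(A,B,\varphi)$; that is, there exist disjoint sets $A,B\subseteq X$, a bijection $\varphi\colon A\to B$, and an element $x\in X\setminus(A\cup B)$ such that $X=A\cup B\cup\{x\}$ and the maximal orthogonal subsets of $(X,\perp)$ are exactly the sets $\{x,a,\varphi(a)\}$ with $a\in A$.
   Context: An orthogonality space is a non-empty set $X$ equipped with a symmetric, irreflexive binary relation $\perp$. An orthogonal subset is a subset whose distinct elements are pairwise orthogonal; it is maximal if it is maximal with respect to inclusion among orthogonal subsets. The rank of $(X,\perp)$ is the supremum of the cardinalities of its orthogonal subsets. For $A\subseteq X$, $A^{\perp}=\{x\in X: x\perp a \text{ for all } a\in A\}$. $(X,\perp)$ fulfills (L1) if, for any two distinct elements $e,f\in X$ with $e\not\perp f$, there exists $g\in X$ with $g\perp e$ and $\{e,f\}^{\perp}=\{e,g\}^{\perp}$. For disjoint sets $A,B$, a bijection $\varphi\colon A\to B$ and an element $x\notin A\cup B$, $\mathbf{3}(A,B,\varphi)$ denotes the orthogonality space on $A\cup B\cup\{x\}$ whose maximal orthogonal subsets are the sets $\{x,a,\varphi(a)\}$, $a\in A$. *)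

(* Defs.v *)
From mathcomp Require Import all_boot.

Set Implicit Arguments.
Unset Strict Implicit.
Unset Printing Implicit Defensive.

Definition orthogonality_space (X : finType) (perp : rel X) : Prop :=
  [/\ 0 < #|X|, symmetric perp & irreflexive perp].

Definition orthogonal_set (X : finType) (perp : rel X) (A : {set X}) : bool :=
  [forall a in A, forall b in A, (a != b) ==> perp a b].

Definition maximal_orthogonal_set (X : finType) (perp : rel X) (A : {set X}) :
  bool := maxset (orthogonal_set perp) A.

Definition orthogonality_rank (X : finType) (perp : rel X) : nat :=
  \max_(A : {set X} | orthogonal_set perp A) #|A|.

Definition orthocomplement (X : finType) (perp : rel X) (A : {set X}) :
  {set X} := [set x | [forall a in A, perp x a]].

Definition L1 (X : finType) (perp : rel X) : Prop :=
  forall e f : X, e != f -> ~~ perp e f ->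
    exists2 g : X, perp g e &
      orthocomplement perp [set e; f] = orthocomplement perp [set e; g].

(* (X, perp) is the space 3(A, B, phi) with distinguished point x.  Only the
   restriction of phi : X -> X to A matters: it is a bijection from A onto B. *)
Definition is_three (X : finType) (perp : rel X) (A B : {set X})
    (phi : X -> X) (x : X) : Prop :=
  [/\ [disjoint A & B],
      {in A &, injective phi} /\ phi @: A = B,
      x \notin A :|: B,
      [set: X] = A :|: B :|: [set x] &
      forall M : {set X}, maximal_orthogonal_set perp M <->
        (exists2 a : X, a \in A & M = [set x; a; phi a])].

(* Main.v *)
(** In rank 3, (L1) forces any two distinct points to have exactly one common
    orthogonal point, so that the orthogonality graph is a friendship graph and
    the claim is the friendship theorem.  If no point is orthogonal to all the
    others, the graph is regular of some degree k >= 3.  Modulo a prime p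
    dividing k - 1, the adjacency matrix A satisfies A^2 = J and AJ = JA = J
    (J the all-one matrix), hence J^2 = J and (A - J)^2 = 0; as a square-zero
    matrix has trace 0, this gives tr A = tr J = 1, whereas tr A = 0. *)

Require Import Defs.
From mathcomp Require Import all_boot.
From mathcomp Require Import all_algebra.

Set Implicit Arguments.
Unset Strict Implicit.
Unset Printing Implicit Defensive.

Import GRing.Theory.

(** Factor [N] as C R with C of full column rank and R of full row rank. Cancelling C on the left
    and R on the right of C R C R = 0 leaves R C = 0, and tr (C R) = tr (R C). This works in any
    characteristic. *)
Lemma mxtrace_square_zero (F : fieldType) (n : nat) (N : 'M[F]_n) :
  (N *m N = 0 -> \tr N = 0)%R.
Proof.
move=> NN0; rewrite -[N in (\tr N)%R]mulmx_base mxtrace_mulC.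
suff -> : (row_base N *m col_base N = 0)%R by rewrite mxtrace0.
apply: (row_free_inj (row_base_free N)); rewrite mul0mx.
apply: (row_full_inj (col_base_full N)); rewrite mulmx0.
by rewrite -mulmxA mulmxA !mulmx_base.
Qed.

Definition friendship (X : finType) (e : rel X) : Prop :=
  forall x y : X, x != y -> exists z : X, forall w : X, e x w && e y w = (w == z).

(** * Friendship graphs: degrees, existence of a hub, structure around a hub *)

Section Friendship.

Variables (X : finType) (e : rel X).
Hypotheses (e_sym : symmetric e) (e_irr : irreflexive e) (e_fr : friendship e).

Local Notation deg x := #|[set y | e x y]|.

Lemma adj_neq (x y : X) : e x y -> x != y.
Proof. by apply: contraTneq => ->; rewrite e_irr. Qed.

Lemma friend_exists (x y : X) : x != y -> exists z, e x z /\ e y z.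
Proof.
by move=> /e_fr [z zP]; exists z; apply/andP; rewrite zP.
Qed.

Lemma friend_unique (x y z w : X) :
  x != y -> e x z -> e y z -> e x w -> e y w -> z = w.
Proof.
move=> /e_fr [t tP] xz yz xw yw.
have := tP z; have := tP w; rewrite xz yz xw yw /=.
by move=> /esym/eqP -> /esym/eqP ->.
Qed.

(** Send each neighbour [z] of [x] to the common neighbour of [z] and [y]. If [z] and [z'] have the
    same image t, both are common neighbours of [x] and t, which differ because t is adjacent to
    [y]; hence [z = z']. *)
Lemma leq_deg_nonadj (x y : X) : x != y -> ~~ e x y -> deg x <= deg y.
Proof.
(* The default [z] is never reached on neighbours of [x]: these differ from [y]. *)
move=> xy nxy; pose f z := odflt z [pick w | e z w && e y w].
have fP z : e x z -> e z (f z) && e y (f z).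
  move=> xz; rewrite /f; case: pickP => //= none.
  have zy : z != y by apply: contraNneq nxy => <-.
  by have [w [zw yw]] := friend_exists zy; have := none w; rewrite zw yw.
rewrite -(@card_in_imset _ _ f [set z | e x z]).
  apply/subset_leq_card/subsetP => _ /imsetP[z xz ->]; rewrite inE in xz.
  by rewrite inE; case/andP: (fP z xz).
move=> z z'; rewrite !inE => xz xz' fzz'.
have /andP[zf yf] := fP z xz; have /andP[zf' _] := fP z' xz'.
rewrite -fzz' in zf'.
apply: (@friend_unique x (f z)) => //; last 2 first.
- by rewrite e_sym.
- by rewrite e_sym.
by apply: contraNneq nxy => ->; rewrite e_sym.
Qed.

Lemma deg_nonadj (x y : X) : x != y -> ~~ e x y -> deg x = deg y.
Proof.
move=> xy nxy; apply/eqP; rewrite eqn_leq !leq_deg_nonadj //.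
  by rewrite eq_sym.
by rewrite e_sym.
Qed.

(** Take [y] not adjacent to [x0], and their common neighbour [w]. A point other than [w] cannot be
    adjacent to both, so it shares their degree; [w] inherits it from a non-neighbour of its own. *)
Lemma regular_of_no_hub (x0 : X) :
  (forall x, exists2 y, y != x & ~~ e x y) ->
  exists2 k, 2 < k & forall x, deg x = k.
Proof.
move=> nohub; have [y yx nxy] := nohub x0.
have xy : x0 != y by rewrite eq_sym.
have [w [xw yw]] := friend_exists xy.
have reg z : z != w -> deg z = deg x0.
  move=> zw; have [->//|zx] := eqVneq z x0.
  have [->|zy] := eqVneq z y; first by rewrite (deg_nonadj xy nxy).
  have [xz|nxz] := boolP (e x0 z); last first.
    by rewrite (@deg_nonadj x0 z) // eq_sym.
  have [yz|nyz] := boolP (e y z).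
    by rewrite (friend_unique xy xz yz xw yw) eqxx in zw.
  by rewrite (deg_nonadj xy nxy) (@deg_nonadj y z) // eq_sym.
have regw : deg w = deg x0.
  have [v vw nwv] := nohub w.
  by rewrite -(reg v vw); apply: deg_nonadj; rewrite // eq_sym.
exists (deg x0); last by move=> z; have [->|/reg] := eqVneq z w.
(* The bound is read off at [w]: its neighbours include [x0], [y] and the common neighbour of [x0]
   and [w]. *)
rewrite -regw.
have [u [xu wu]] := friend_exists (adj_neq xw).
have ux : u != x0 by rewrite eq_sym adj_neq.
have uy : u != y by apply: contraNneq nxy => <-.
have s3 : uniq [:: u; x0; y] by rewrite /= !inE negb_or ux uy xy.
rewrite -[3]/(size [:: u; x0; y]) -(card_uniqP s3); apply/subset_leq_card/subsetP => z.
by rewrite !inE => /or3P[] /eqP-> //; rewrite e_sym.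
Qed.

Local Open Scope ring_scope.

Lemma not_regular_modp (x0 : X) (k p : nat) :
  prime p -> (p %| k.-1)%N -> (0 < k)%N -> (forall x, deg x = k) -> False.
Proof.
move=> p_pr pk k0 reg.
have pcF : p \in [pchar 'F_p] by rewrite pchar_Fp.
have k1 : k%:R = 1 :> 'F_p.
  by rewrite -(prednK k0) -natr1 (eqP (_ : k.-1%:R == 0 :> 'F_p)) ?add0r // -(dvdn_pcharf pcF).
pose n := #|X|; pose v (i : 'I_n) : X := enum_val i.
pose A : 'M['F_p]_n := \matrix_(i, j) (e (v i) (v j))%:R.
pose J : 'M['F_p]_n := const_mx 1.
have sumE (P : pred X) : \sum_(i < n) (P (v i))%:R = #|[set y | P y]|%:R :> 'F_p.
  rewrite -(@big_enum_val _ _ _ _ X (fun y => (P y)%:R)) -natr_sum.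
  by rewrite -sum1dep_card [in RHS]big_mkcond.
have A_sym i j : A i j = A j i by rewrite !mxE e_sym.
have AJ : A *m J = J.
  apply/matrixP => i j; rewrite !mxE.
  under eq_bigr do rewrite !mxE mulr1.
  by rewrite (sumE (e (v i))) reg k1.
have AT : A^T = A by apply/matrixP => i j; rewrite mxE A_sym.
have JT : J^T = J by rewrite trmx_const.
have JA : J *m A = J by rewrite -[LHS]trmxK trmx_mul AT JT AJ JT.
(* Entries of the square count common neighbours: one off the diagonal, and the degree k, which is 1
   modulo p, on it. *)
have AA : A *m A = J.
  apply/matrixP => i j; rewrite !mxE.
  under eq_bigr do rewrite A_sym !mxE e_sym [e (v _) (v j)]e_sym -natrM mulnb.
  rewrite (sumE (fun y => e (v i) y && e (v j) y)).
  have [->|ij] := eqVneq i j.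
    rewrite -[RHS]k1 -(reg (v j)); congr (_%:R); apply: eq_card => y.
    by rewrite !inE andbb.
  have /e_fr[z zP] : v i != v j by rewrite (inj_eq enum_val_inj).
  suff -> : [set y | e (v i) y && e (v j) y] = [set z] by rewrite cards1.
  by apply/setP => y; rewrite !inE zP.
have JJ : J *m J = J by rewrite -{1}AA -mulmxA !AJ.
have trA : \tr A = 0 by rewrite /mxtrace big1 // => i _; rewrite mxE e_irr.
have trJ : \tr J = 1.
  (* A diagonal entry of [J *m J] is the sum of n ones, which is also [\tr J]; [x0] supplies an
     index at which to compare it with [J]. *)
  have /matrixP/(_ (enum_rank x0) (enum_rank x0)) := JJ.
  rewrite !mxE => <-; apply: eq_bigr => i _.
  by rewrite !mxE mulr1.
have: \tr (A - J) = 0.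
  by apply: mxtrace_square_zero; rewrite mulmxBl !mulmxBr AA AJ JA JJ !subrr.
rewrite raddfB /= trA trJ sub0r => /eqP.
by rewrite oppr_eq0 oner_eq0.
Qed.

Local Close Scope ring_scope.

Lemma friendship_hub (x0 : X) : exists x, forall y, y != x -> e x y.
Proof.
have [/existsP[x /forallP xP]|nohub] := boolP [exists x, forall y, (y != x) ==> e x y].
  by exists x => y yx; apply: implyP (xP y) yx.
have /(regular_of_no_hub x0)[k k2 reg] x : exists2 y, y != x & ~~ e x y.
  move: nohub; rewrite negb_exists => /forallP/(_ x).
  by rewrite negb_forall => /existsP[y]; rewrite negb_imply => /andP[]; exists y.
(* Here [2 < k] matters: it gives k - 1 a prime divisor. *)
have k1 : 1 < k.-1 by case: k k2 {reg} => // [[]].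
have := @not_regular_modp x0 k (pdiv k.-1) (pdiv_prime k1) (pdiv_dvd _).
by case=> //; apply: ltn_trans k2.
Qed.

(** Sending [z] to its common neighbour with the hub is a fixed-point-free involution [f] of the
    other points, and the pairs it forms are the only edges avoiding the hub. *)
Lemma hub_is_three (x y0 : X) :
  y0 != x -> (forall y, y != x -> e x y) -> exists A B phi, is_three e A B phi x.
Proof.
move=> y0x hub; pose f z := odflt z [pick w | e z w && e x w].
have fP z : z != x -> e z (f z) /\ e x (f z).
  move=> zx; rewrite /f; case: pickP => /= [w /andP[]//|none].
  by have [w [zw xw]] := friend_exists zx; have := none w; rewrite zw xw.
have fx z : z != x -> f z != x.
  by move=> zx; rewrite eq_sym adj_neq //; case: (fP z zx).
have fU z w : z != x -> e z w -> e x w -> w = f z.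
  by move=> zx zw xw; have [? ?] := fP z zx; apply: (friend_unique zx).
have fK z : z != x -> f (f z) = z.
  move=> zx; apply/esym/fU; rewrite ?fx ?hub //.
  by rewrite e_sym; case: (fP z zx).
have fN z : z != x -> enum_rank (f z) != enum_rank z :> nat.
  move=> zx; rewrite (inj_eq val_inj) (inj_eq enum_rank_inj) eq_sym adj_neq //.
  by case: (fP z zx).
(* The enumeration order selects one point of each pair for [A], the other for [B]. *)
pose A := [set z | (z != x) && (enum_rank z < enum_rank (f z))].
pose B := [set z | (z != x) && (enum_rank (f z) < enum_rank z)].
have tri z y : z != x -> y != x -> y != z -> e z y -> y = f z.
  by move=> zx yx yz zy; apply: fU; rewrite ?hub.
have orth z : z != x -> orthogonal_set e [set x; z; f z].
  move=> zx; have [zf xf] := fP z zx.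
  apply/forall_inP => a aM; apply/forall_inP => b bM; apply/implyP.
  move: aM bM; rewrite !inE -!orbA => /or3P[] /eqP-> /or3P[] /eqP->;
    by rewrite ?eqxx //; move=> _; rewrite ?zf ?xf ?hub ?fx // e_sym ?hub ?fx.
have sub (M : {set X}) z : orthogonal_set e M -> z \in M -> z != x ->
    M \subset [set x; z; f z].
  move=> /forall_inP oM zM zx; apply/subsetP => y yM; rewrite !inE.
  have [//|yx] := eqVneq y x; have [//|yz] := eqVneq y z; apply/eqP/tri => //.
  by have /forall_inP/(_ y yM) := oM z zM; rewrite eq_sym yz.
exists A, B, f; split.
- apply/pred0P => z /=; rewrite !inE; apply/negP.
  by case/andP=> /andP[_ lt1] /andP[_ /(ltn_trans lt1)]; rewrite ltnn.
- split.
    move=> z w; rewrite !inE => /andP[zx _] /andP[wx _] fzw.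
    by rewrite -(fK z) // fzw fK.
  apply/setP => z; apply/imsetP/idP => [[w]|].
    by rewrite !inE => /andP[wx lt] ->; rewrite fx // fK.
  rewrite inE => /andP[zx lt]; exists (f z); last by rewrite fK.
  by rewrite inE fx // fK.
- by rewrite !inE eqxx.
- apply/setP => z; rewrite !inE; have [//|zx] := eqVneq z x.
  by rewrite orbF /=; have := fN z zx; rewrite neq_ltn orbC => ->.
move=> M; split=> [/maxsetP[oM maxM]|[a]].
  suff [z zM zx] : exists2 z, z \in M & z != x.
    have eM : M = [set x; z; f z] by rewrite (maxM _ (orth z zx)) ?sub.
    have := fN z zx; rewrite neq_ltn => /orP[lt|lt].
      exists (f z); first by rewrite inE fx // fK.
      by rewrite fK // eM setUAC.
    by exists z; rewrite // inE zx.
  (* A maximal set inside [[set x]] would be strictly contained in the triple through [y0]. *)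
  apply/exists_inP; apply: contraT; rewrite negb_exists_in => /forall_inP noz.
  have Mx : M \subset [set x; y0; f y0].
    by apply/subsetP => z /noz; rewrite negbK !inE => ->.
  move: (noz y0); rewrite -(maxM _ (orth y0 y0x) Mx) !inE eqxx orbT y0x.
  by move=> /(_ isT).
rewrite inE => /andP[ax _] ->; apply/maxsetP; split; first exact: orth.
move=> N oN sN; apply/eqP; rewrite eqEsubset sN andbT; apply: sub => //.
by apply: (subsetP sN); rewrite !inE eqxx orbT.
Qed.

End Friendship.

(** * From (L1) and rank 3 to the friendship property *)

Section L1Space.

Variables (X : finType) (perp : rel X).
Hypotheses (perp_sym : symmetric perp) (perp_irr : irreflexive perp).
Hypotheses (rank3 : orthogonality_rank perp = 3) (perp_L1 : L1 perp).

(** Trades a non-orthogonal pair for an orthogonal one with the same common neighbours. *)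
Lemma L1_common (a b : X) : a != b -> ~~ perp a b ->
  exists2 c, perp a c & forall z, perp a z && perp b z = perp a z && perp c z.
Proof.
move=> ab nab; have [c ca abE] := perp_L1 ab nab.
have oc u v z : (z \in orthocomplement perp [set u; v]) = perp u z && perp v z.
  rewrite inE; apply/forall_inP/andP => [uv|[uz vz] w].
    by rewrite ![perp _ z]perp_sym !uv // !inE eqxx ?orbT.
  by rewrite !inE perp_sym => /orP[] /eqP->.
by exists c => [|z]; [rewrite perp_sym | rewrite -!oc abE].
Qed.

Lemma no_orthogonal_quadruple (a b c d : X) :
  perp a b -> perp a c -> perp a d -> perp b c -> perp b d -> perp c d -> False.
Proof.
move=> ab ac ad bc bd cd.
have neq := adj_neq perp_irr.
have s4 : uniq [:: a; b; c; d] by rewrite /= !inE !negb_or !neq.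
suff: #|[set z in [:: a; b; c; d]]| <= orthogonality_rank perp.
  by rewrite rank3 cardsE (card_uniqP s4).
apply: (leq_bigmax_cond (F := fun A : {set X} => #|A|)).
apply/forall_inP => x xM; apply/forall_inP => y yM; apply/implyP.
by move: xM yM; rewrite !inE => /or4P[] /eqP-> /or4P[] /eqP->;
  rewrite ?eqxx //; move=> _; rewrite // perp_sym.
Qed.

Lemma orthogonal_triple : exists a b c, [/\ perp a b, perp a c & perp b c].
Proof.
have [|A oA cardA] := @eq_bigmax_cond _ (orthogonal_set perp) (fun A : {set X} => #|A|).
  apply/card_gt0P; exists set0; apply/forall_inP => x.
  by rewrite inE.
have /card_gt2P[a [b [c [[aA bA cA] [ab bc ca]]]]] : 2 < #|A|.
  by rewrite -cardA -/(orthogonality_rank perp) rank3.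
have ortho x y : x \in A -> y \in A -> x != y -> perp x y.
  by move=> xA yA; apply/implyP; move/forall_inP/(_ x xA)/forall_inP: oA; apply.
by exists a, b, c; rewrite !ortho // eq_sym.
Qed.

(** By (L1) one may assume [perp a b]. If [z] and [w] were distinct, then [w], or when [z] and [w]
    are not orthogonal its (L1) replacement [u], would form an orthogonal quadruple with [a], [b],
    [z]. *)
Lemma common_perp_unique (a b z w : X) :
  a != b -> perp a z -> perp b z -> perp a w -> perp b w -> z = w.
Proof.
move=> neq_ab.
wlog ab : b {neq_ab} / perp a b => [IH az bz aw bw|].
  have [ab|nab] := boolP (perp a b); first exact: (IH b).
  have [c ac cE] := L1_common neq_ab nab.
  have /andP[_ cz] : perp a z && perp c z by rewrite -cE az.
  have /andP[_ cw] : perp a w && perp c w by rewrite -cE aw.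
  exact: (IH c).
move=> az bz aw bw; apply/eqP; apply: contraT => zw.
have [/(no_orthogonal_quadruple ab az aw bz bw)//|nzw] := boolP (perp z w).
have [u zu uE] := L1_common zw nzw.
have /andP[_ ua] : perp z a && perp u a by rewrite -uE !(perp_sym _ a) az.
have /andP[_ ub] : perp z b && perp u b by rewrite -uE !(perp_sym _ b) bz.
by case: (@no_orthogonal_quadruple a b z u); rewrite // perp_sym.
Qed.

Definition in_triple (a : X) : Prop :=
  exists b c, [/\ perp a b, perp a c & perp b c].

(** If [d] is neither equal nor orthogonal to [b], (L1) replaces [b] by some [z] orthogonal to [d],
    and [a] stays a common neighbour. *)
Lemma in_triple_edge (a d : X) :
  in_triple a -> perp a d -> exists2 z, perp a z & perp d z.
Proof.
move=> [b [c [ab ac bc]]] ad; have [->|db] := eqVneq d b; first by exists c.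
have [pdb|npdb] := boolP (perp d b); first by exists b.
have [z dz zE] := L1_common db npdb; exists z => //.
have /andP[_ za] : perp d a && perp z a by rewrite -zE !(perp_sym _ a) ad.
by rewrite perp_sym.
Qed.

Lemma in_triple_common (a d : X) :
  in_triple a -> a != d -> exists2 z, perp a z & perp d z.
Proof.
move=> ta ad; have [pad|npad] := boolP (perp a d); first exact: in_triple_edge.
have [c ac cE] := L1_common ad npad.
have [z az cz] := in_triple_edge ta ac.
have /andP[_ dz] : perp a z && perp d z by rewrite cE az.
by exists z.
Qed.

(** Rank 3 gives one triple, through some [a]. Triples then spread along the path from [a] to [d]
    via a common neighbour [z], each edge at a point of a triple lying in a triple. *)
Lemma all_in_triple (d : X) : in_triple d.
Proof.
have [a ta] : exists a, in_triple a by exact: orthogonal_triple.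
have [<-//|ad] := eqVneq a d.
have [z az dz] := in_triple_common ta ad.
have [u au zu] := in_triple_edge ta az.
have tz : in_triple z by exists a, u; rewrite perp_sym.
have [|w zw dw] := @in_triple_edge z d tz; first by rewrite perp_sym.
by exists z, w.
Qed.

Lemma L1_friendship : friendship perp.
Proof.
move=> a b ab; have [z az bz] := in_triple_common (all_in_triple a) ab.
exists z => w; apply/andP/eqP => [[aw bw]|->//].
exact: (common_perp_unique ab).
Qed.

End L1Space.

Theorem theorem28 (X : finType) (perp : rel X)
    (hX : orthogonality_space perp)
    (hrank : orthogonality_rank perp = 3)
    (hL1 : L1 perp) :
  exists (A B : {set X}) (phi : X -> X) (x : X), is_three perp A B phi x.
Proof.
have [_ sym irr] := hX.
have fr := L1_friendship sym irr hrank hL1.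
have [a [b [_ [ab _ _]]]] := orthogonal_triple hrank.
have [x hub] := friendship_hub sym irr fr a.
have [y yx] : exists y, y != x.
  have [ax|] := eqVneq a x; last by exists a.
  by exists b; rewrite -ax eq_sym (adj_neq irr ab).
have [A [B [phi three]]] := hub_is_three sym irr fr yx hub.
by exists A, B, phi, x.
Qed.
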